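(* Let $G$ and $H$ be undirected simple graphs on $N=\{1,\dots,n\}$. If $G\cup H=K_N$ is the complete graph, then $\mathcal M(G,H)$ is smooth. In fact, the intersection $\mathcal M(G,H)=\mathcal M(G)\cap\mathcal M(H)^{-1}$ of the smooth submanifolds $\mathcal M(G)$ and $\mathcal M(H)^{-1}$ of $\mathrm{PD}_n$ is transverse at every intersection point.
   Context: $E_G$ denotes the edge set of $G$; $G\cup H$ is the graph on $N$ with edge set $E_G\cup E_H$. $\mathrm{PD}_n$ is the set of real symmetric positive definite $n\times n$ matrices, an open subset of the space $\mathrm{Sym}^2(\mathbb R^n)$ of symmetric matrices. $\mathcal M(G)=\{\Sigma\in\mathrm{PD}_n:(\Sigma^{-1})_{ij}=0\text{ for all }i\neq j,\ ij\notin E_G\}$; $\mathcal M(H)^{-1}=\{\Sigma^{-1}:\Sigma\in\mathcal M(H)\}=\{\Sigma\in\mathrm{PD}_n:\Sigma_{kl}=0\text{ for all }k\ne l,\ kl\notin E_H\}$; $\mathcal M(G,H)=\mathcal M(G)\cap\mathcal M(H)^{-1}$. Both $\mathcal M(G)$ and $\mathcal M(H)^{-1}$ are smooth submanifolds of $\mathrm{PD}_n$. Two submanifolds $A,B$ of a manifold $X$ intersect transversely at $P\in A\cap B$ if $T_PA+T_PB=T_PX$. Smoothness of $\mathcal M(G,H)$ here is as a submanifold of $\mathrm{PD}_n$. *)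

(* Defs.v *)
From HB Require Import structures.
From mathcomp Require Import all_boot all_order all_algebra.
From mathcomp Require Import all_classical all_reals all_analysis.
Set Implicit Arguments.
Unset Strict Implicit.
Unset Printing Implicit Defensive.
Import Order.TTheory GRing.Theory Num.Theory.
Import numFieldNormedType.Exports.
Local Open Scope classical_set_scope.
Local Open Scope ring_scope.

Record sgraph (n : nat) := SGraph {
  edge :> rel 'I_n;
  edge_sym : symmetric edge;
  edge_irr : irreflexive edge }.

Definition graph_union_rel n (G H : sgraph n) : rel 'I_n :=
  fun i j => G i j || H i j.

Lemma graph_union_sym n (G H : sgraph n) : symmetric (graph_union_rel G H).
Proof. by move=> i j; rewrite /graph_union_rel edge_sym (edge_sym H). Qed.

Lemma graph_union_irr n (G H : sgraph n) : irreflexive (graph_union_rel G H).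
Proof. by move=> i; rewrite /graph_union_rel !edge_irr. Qed.

Definition graph_union n (G H : sgraph n) : sgraph n :=
  SGraph (graph_union_sym G H) (graph_union_irr G H).

Definition is_complete n (G : sgraph n) : Prop :=
  forall i j : 'I_n, i != j -> G i j.

(* [L] is meant to be a linear subspace of [V] and [U] a subset of [L] that is
   open in [L]: only values of [f] on [U] and derivatives in directions of [L]
   intervene, so this is C^k-smoothness of [f] as a function on the open
   subset [U] of the vector space [L] (all iterated directional derivatives of
   order at most [k] exist and are continuous on [U]), for [L] of finite
   dimension. *)
Fixpoint Ck_on (R : realType) (V W : normedModType R) (k : nat)
    (L U : set V) (f : V -> W) : Prop :=
  {within U, continuous f} /\
  if k is k'.+1 then
    forall v, L v ->
      (forall x, U x -> derivable f x v) /\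
      Ck_on k' L U (fun x => 'D_v f x)
  else True.

Definition smooth_on (R : realType) (V W : normedModType R)
    (L U : set V) (f : V -> W) : Prop :=
  forall k, Ck_on k L U f.

Definition open_in (T : topologicalType) (L U : set T) : Prop :=
  exists2 O : set T, open O & U = O `&` L.

Definition diffeomorphism (R : realType) (V : normedModType R)
    (L U W : set V) (f g : V -> V) : Prop :=
  [/\ open_in L U, open_in L W, f @` U = W,
      (forall x, U x -> g (f x) = x) &
      smooth_on L U f /\ smooth_on L W g].

(* Embedded C^oo submanifolds [A], of some constant dimension [d], of an open
   subset [X] of a linear subspace [L] of matrices: around each point, a
   diffeomorphism [f] between open subsets of [L] carries [A] onto a piece of
   a [d]-dimensional linear subspace [K] of [L]. *)
Definition smooth_submanifold (R : realType) (n : nat)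
    (L X A : set 'M[R]_n) : Prop :=
  A `<=` X /\
  exists d : nat, forall P, A P ->
    exists (U W : set 'M[R]_n) (f g : 'M[R]_n -> 'M[R]_n)
           (K : {vspace 'M[R]_n}),
      [/\ U P, U `<=` X, diffeomorphism L U W f g,
          \dim K = d /\ [set` K] `<=` L &
          f @` (A `&` U) = [set` K] `&` W].

(* Velocities at [P] of smooth curves in [A]. *)
Definition tangent_space (R : realType) (V : normedModType R)
    (A : set V) (P : V) : set V :=
  [set v | exists (c : R -> V) (e : R),
     [/\ 0 < e, smooth_on setT [set t : R | `|t| < e] c,
         (forall t : R, `|t| < e -> A (c t)), c 0 = P & derive1 c 0 = v]].

Definition transverse_at (R : realType) (V : normedModType R)
    (X A B : set V) (P : V) : Prop :=
  [set a + b | a in tangent_space A P & b in tangent_space B P] =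
  tangent_space X P.

Definition Sym2 (R : realType) (n : nat) : set 'M[R]_n := [set S | S^T = S].

Definition PD (R : realType) (n : nat) : set 'M[R]_n :=
  [set S | Sym2 S /\
     forall x : 'cV[R]_n, x != 0 -> 0 < (x^T *m S *m x) ord0 ord0].

Definition model (R : realType) (n : nat) (G : sgraph n) : set 'M[R]_n :=
  [set S | PD S /\
     forall i j : 'I_n, i != j -> ~~ G i j -> invmx S i j = 0].

Definition model_inv (R : realType) (n : nat) (H : sgraph n) : set 'M[R]_n :=
  [set invmx S | S in model H].

Definition double_model (R : realType) (n : nat) (G H : sgraph n) :
    set 'M[R]_n :=
  model G `&` model_inv H.

Arguments Sym2 : clear implicits.
Arguments PD : clear implicits.
Arguments model R {n} G _ : rename.
Arguments model_inv R {n} H _ : rename.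
Arguments double_model R {n} G H _ : rename.

(* Main.v *)
Require Import Defs.
From HB Require Import structures.
From mathcomp Require Import all_boot all_order all_algebra.
From mathcomp Require Import all_classical all_reals all_analysis.
From mathcomp Require Import ring lra.
Set Implicit Arguments.
Unset Strict Implicit.
Unset Printing Implicit Defensive.
Import Order.TTheory GRing.Theory Num.Theory numFieldNormedType.Exports.
Local Open Scope classical_set_scope.
Local Open Scope ring_scope.

(* Let C be the set of non-edges of G; completeness of G u H says that C
   consists of edges of H. Near P in PD_n consider the mixed coordinates
   f(S)_ij = -(S^-1)_ij for ij in C and f(S)_ij = S_ij otherwise, in which
   M(G,H) is cut out by the vanishing of coordinates. The differential of f at
   P sends D to D off C and to P^-1 D P^-1 on C, and is injective: if it kills
   D then tr(D^T P^-1 D P^-1) = 0, hence D = 0. Since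
   S^-1 - T^-1 = - S^-1 (S - T) T^-1, f is strictly differentiable and Banach's
   fixed point theorem yields a local inverse g. All iterated derivatives of g
   are rational functions of the entries of g, so g is smooth.
   For transversality, given a symmetric v, the matrix b supported on C with
   P^-1 b P^-1 = P^-1 v P^-1 on C is tangent to M(H)^-1 and v - b is tangent
   to M(G). *)

(** * Smoothness of rational functions *)

Section RationalFunctions.
Context {R : realType} {V : normedModType R}.
Variables (B : set (V -> R)) (U : set V).

(* The closure under [rat_ext] makes the values outside of [U], in particular
   those of [invmx] at singular matrices, irrelevant. *)
Inductive rational_in : (V -> R) -> Prop :=
| rat_gen f : B f -> rational_in f
| rat_cst c : rational_in (fun=> c)
| rat_add f g : rational_in f -> rational_in g ->
    rational_in (fun x => f x + g x)
| rat_mul f g : rational_in f -> rational_in g ->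
    rational_in (fun x => f x * g x)
| rat_inv f : (forall x, U x -> f x != 0) -> rational_in f ->
    rational_in (fun x => (f x)^-1)
| rat_ext f g : (forall x, U x -> f x = g x) -> rational_in f -> rational_in g.

(** Derivatives of generators need only be rational in the generators, not constant. This covers
    matrix coordinates as well as the entries of an implicitly given inverse map, whose derivatives
    involve those entries again. *)
Definition differential_generators :=
  forall f, B f -> (forall x, U x -> {for x, continuous f}) /\
    forall v, exists2 f', rational_in f' &
      forall x, U x -> is_derive x v f (f' x).

Hypotheses (oU : open U) (hB : differential_generators).

Lemma near_open (P : V -> Prop) x :
  (forall y, U y -> P y) -> U x -> \forall y \near x, P y.
Proof. by move=> UP Ux; near=> y; apply: UP; near: y; exact: open_nbhs_nbhs.
Unshelve. all: by end_near. Qed.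

Lemma rational_in_continuous f x :
  rational_in f -> U x -> {for x, continuous f}.
Proof.
move=> rf Ux; elim: rf => {f}.
- by move=> f /hB[/(_ x Ux)].
- by move=> c; exact: cst_continuous.
- by move=> f g _ cf _ cg; apply: cvgD.
- by move=> f g _ cf _ cg; apply: cvgM.
- by move=> f f0 _ cf; apply: cvgV => //; exact: f0.
- move=> f g fg _ cf; apply: cvg_trans; last first.
    by rewrite -(fg x Ux); exact: cf.
  by apply: near_eq_cvg; apply: near_open Ux => y /fg.
Qed.

Lemma rational_in_derive v f : rational_in f ->
  exists2 f', rational_in f' & forall x, U x -> is_derive x v f (f' x).
Proof.
elim=> {f}.
- by move=> f /hB[_ /(_ v)].
- by move=> c; exists (fun=> 0) => [|x _]; [exact: rat_cst|exact: is_derive_cst].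
- move=> f g _ [f' rf' df] _ [g' rg' dg].
  exists (fun x => f' x + g' x); first exact: rat_add.
  by move=> x Ux; apply: is_deriveD; [exact: df|exact: dg].
- move=> f g rf [f' rf' df] rg [g' rg' dg].
  exists (fun x => f x * g' x + g x * f' x).
    by apply: rat_add; apply: rat_mul.
  by move=> x Ux; apply: is_deriveM; [exact: df|exact: dg].
- move=> f f0 rf [f' rf' df].
  exists (fun x => -1 * ((f x)^-1 * (f x)^-1) * f' x).
    apply: rat_mul => //; apply: rat_mul; first exact: rat_cst.
    by apply: rat_mul; exact: rat_inv.
  move=> x Ux; have [dfx vfx] := df x Ux.
  apply: DeriveDef; first by apply: derivableV => //; exact: f0.
  rewrite deriveV//; last exact: f0.
  by rewrite vfx mulN1r expr2 invfM.
- move=> f g fg _ [f' rf' df]; exists f' => // x Ux.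
  have [dfx vfx] := df x Ux.
  have fgx : \near x, f x = g x by exact: near_open Ux.
  apply: DeriveDef; first exact: near_eq_derivable dfx.
  by rewrite -(near_eq_derive v fgx).
Qed.

Lemma rational_sum (I : Type) (r : seq I) (P : pred I) (F : I -> V -> R) :
  (forall i, P i -> rational_in (F i)) ->
  rational_in (fun x => \sum_(i <- r | P i) F i x).
Proof.
move=> rF; elim: r => [|i r IHr].
  by apply: rat_ext (rat_cst 0) => x _; rewrite big_nil.
case: (boolP (P i)) => Pi; last first.
  by apply: rat_ext IHr => x _; rewrite big_cons (negbTE Pi).
by apply: rat_ext (rat_add (rF i Pi) IHr) => x _; rewrite big_cons Pi.
Qed.

Lemma rational_prod (I : Type) (r : seq I) (P : pred I) (F : I -> V -> R) :
  (forall i, P i -> rational_in (F i)) ->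
  rational_in (fun x => \prod_(i <- r | P i) F i x).
Proof.
move=> rF; elim: r => [|i r IHr].
  by apply: rat_ext (rat_cst 1) => x _; rewrite big_nil.
case: (boolP (P i)) => Pi; last first.
  by apply: rat_ext IHr => x _; rewrite big_cons (negbTE Pi).
by apply: rat_ext (rat_mul (rF i Pi) IHr) => x _; rewrite big_cons Pi.
Qed.

(** * Matrices of rational functions *)

Definition rational_mx m n (F : V -> 'M[R]_(m, n)) :=
  forall i j, rational_in (fun x => F x i j).

Lemma rational_mx_cst m n (A : 'M[R]_(m, n)) : rational_mx (fun=> A).
Proof. by move=> i j; exact: rat_cst. Qed.

Lemma rational_mxD m n (F G : V -> 'M[R]_(m, n)) :
  rational_mx F -> rational_mx G -> rational_mx (fun x => F x + G x).
Proof.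
by move=> rF rG i j; apply: rat_ext (rat_add (rF i j) (rG i j)) => x _;
  rewrite mxE.
Qed.

Lemma rational_mxM m n p (F : V -> 'M[R]_(m, n)) (G : V -> 'M[R]_(n, p)) :
  rational_mx F -> rational_mx G -> rational_mx (fun x => F x *m G x).
Proof.
move=> rF rG i j.
have r : rational_in (fun x => \sum_k F x i k * G x k j).
  by apply: rational_sum => k _; exact: rat_mul.
by apply: rat_ext r => x _; rewrite mxE.
Qed.

Lemma rational_det n (F : V -> 'M[R]_n) :
  rational_mx F -> rational_in (fun x => \det (F x)).
Proof.
move=> rF; apply: rational_sum => s _; apply: rat_mul; first exact: rat_cst.
by apply: rational_prod => i _; exact: rF.
Qed.

(** Cramer's rule: where [F x] is invertible, its inverse is the adjugate divided by a nonvanishing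
    determinant, both polynomial in the entries. *)
Lemma rational_invmx n (F : V -> 'M[R]_n) :
  (forall x, U x -> F x \in unitmx) -> rational_mx F ->
  rational_mx (fun x => invmx (F x)).
Proof.
move=> uF rF i j.
have radj : rational_in (fun x => \adj (F x) i j).
  have : rational_in (fun x => cofactor (F x) j i).
    apply: rat_mul; first exact: rat_cst.
    apply: rational_det => k l.
    by apply: rat_ext (rF (lift j k) (lift i l)) => x _; rewrite !mxE.
  by apply: rat_ext => x _; rewrite mxE.
have rdet : rational_in (fun x => (\det (F x))^-1).
  apply: rat_inv; last exact: rational_det.
  by move=> x /uF; rewrite unitmxE unitfE.
by apply: rat_ext (rat_mul rdet radj) => x /uF uFx; rewrite /invmx uFx [RHS]mxE.
Qed.

Lemma rational_mx_continuous m n (F : V -> 'M[R]_(m, n)) x :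
  rational_mx F -> U x -> {for x, continuous F}.
Proof.
move=> rF Ux; apply/cvgrPdist_le => /= e e0; near=> y.
rewrite /Num.Def.normr/= mx_normrE (bigmax_le _ (ltW e0))//= => i _.
rewrite !mxE/=; move: i; near: y; apply: filter_forall => /= i.
by have /cvgrPdist_le := rational_in_continuous (rF i.1 i.2) Ux; apply.
Unshelve. all: by end_near. Qed.

Lemma rational_mx_derivable m n (F : V -> 'M[R]_(m, n)) x v :
  rational_mx F -> U x -> derivable F x v.
Proof.
move=> rF Ux; apply/derivable_mxP => i j.
by have [f' _ /(_ x Ux)[]] := rational_in_derive v (rF i j).
Qed.

(** Induction on the order: rational matrices are continuous and derivable on [U], and their
    directional derivatives are again rational. *)
Lemma rational_mx_smooth m n (F : V -> 'M[R]_(m, n)) :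
  rational_mx F -> smooth_on setT U F.
Proof.
move=> rF k; elim: k F rF => [|k IHk] F rF /=.
  split=> //; rewrite continuous_open_subspace// => x; rewrite inE => Ux.
  exact: rational_mx_continuous.
split.
  rewrite continuous_open_subspace// => x; rewrite inE => Ux.
  exact: rational_mx_continuous.
move=> v _; split; first by move=> x; exact: rational_mx_derivable.
apply: IHk => i j; have [f' rf' df'] := rational_in_derive v (rF i j).
apply: rat_ext rf' => x Ux; rewrite derive_mx ?mxE.
  by have [_ ->] := df' x Ux.
exact: rational_mx_derivable.
Qed.

End RationalFunctions.

Lemma smooth_on_sub (R : realType) (V W : normedModType R) (L L' U U' : set V)
    (f : V -> W) :
  L' `<=` L -> U' `<=` U -> smooth_on L U f -> smooth_on L' U' f.
Proof.
move=> LL UU sf k; move: (sf k) => {sf}; elim: k f => [|k IHk] f /= [cf df].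
  by split=> //; exact: continuous_subspaceW cf.
split; first exact: continuous_subspaceW cf.
move=> v /LL /df[dfv sfv]; split; last exact: IHk.
by move=> x /UU /dfv.
Qed.

Definition coordinates (R : realType) n : set ('M[R]_n -> R) :=
  [set f | exists i j, f = fun S : 'M[R]_n => S i j].

Lemma coordinates_differential (R : realType) n (U : set 'M[R]_n) :
  differential_generators (@coordinates R n) U.
Proof.
move=> _ [i [j ->]]; split; first by move=> x _; exact: coord_continuous.
move=> v; exists (fun=> v i j) => [|x _]; first exact: rat_cst.
have h : (fun S : 'M[R]_n => (id S : 'M[R]_n) i j) = (fun S => S i j) by [].
have d := @derivable_id R 'M[R]_n x v.
apply: DeriveDef; first by have /derivable_mxP := d; apply.
have := derive_mx d; rewrite derive_id => /matrixP/(_ i j).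
by rewrite mxE => <-.
Qed.

Lemma id_differential (R : realType) (U : set R) :
  differential_generators [set (id : R -> R)] U.
Proof.
move=> _ ->; split; first by move=> x _; exact: cvg_id.
by move=> v; exists (fun=> v) => [|x _]; [exact: rat_cst|exact: is_derive_id].
Qed.

(** * Positive definite matrices *)

Section BilinearForm.
Context {R : realType} {n : nat}.
Implicit Types (A S Q : 'M[R]_n) (x y : 'cV[R]_n).

Definition bform A x y : R := (x^T *m A *m y) ord0 ord0.

Lemma bformDl A x1 x2 y : bform A (x1 + x2) y = bform A x1 y + bform A x2 y.
Proof. by rewrite /bform linearD !mulmxDl mxE. Qed.

Lemma bformDr A x y1 y2 : bform A x (y1 + y2) = bform A x y1 + bform A x y2.
Proof. by rewrite /bform mulmxDr mxE. Qed.

Lemma bformZl A c x y : bform A (c *: x) y = c * bform A x y.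
Proof. by rewrite /bform linearZ -!scalemxAl mxE. Qed.

Lemma bformZr A c x y : bform A x (c *: y) = c * bform A x y.
Proof. by rewrite /bform -scalemxAr mxE. Qed.

Lemma bform_addm A1 A2 x y : bform (A1 + A2) x y = bform A1 x y + bform A2 x y.
Proof. by rewrite /bform mulmxDr mulmxDl mxE. Qed.

Lemma bform_sym A x y : A^T = A -> bform A x y = bform A y x.
Proof.
move=> sA; rewrite /bform -[LHS](mxE trmx_key (fun j i => _ i j)) /=.
by rewrite -/(trmx _) !trmx_mul trmxK sA mulmxA.
Qed.

Lemma bform_delta A i y : bform A (delta_mx i ord0) y = (A *m y) i ord0.
Proof. by rewrite /bform trmx_delta -mulmxA -rowE mxE. Qed.

Lemma bform_delta2 A i j : bform A (delta_mx i ord0) (delta_mx j ord0) = A i j.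
Proof. by rewrite bform_delta -colE mxE. Qed.

Lemma bform_sum A x : bform A x x = \sum_i \sum_j A i j * (x i ord0 * x j ord0).
Proof.
rewrite /bform -mulmxA mxE; apply: eq_bigr => i _; rewrite !mxE mulr_sumr.
by apply: eq_bigr => j _; rewrite mulrCA.
Qed.

Definition expand_bform := (bformDl, bformDr, bformZl, bformZr).

Lemma psd_row0 A i j : A^T = A -> (forall x, 0 <= bform A x x) ->
  A i i = 0 -> A i j = 0.
Proof.
move=> sA pA Aii; apply/eqP/negP => /negP Aij.
(* As [A i i = 0], the form at [c e_i + e_j] is [2 c A_ij + A_jj], affine in [c]; this choice of [c]
   gives it the value -1. *)
have := pA (- (A j j + 1) / (2 * A i j) *: delta_mx i ord0 + delta_mx j ord0).
rewrite !expand_bform !bform_delta2 Aii.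
have -> : A j i = A i j by rewrite -[in LHS]sA mxE.
rewrite !mulr0 add0r.
have -> : - (A j j + 1) / (2 * A i j) * A i j = - (A j j + 1) / 2 by field.
suff -> : - (A j j + 1) / 2 + (- (A j j + 1) / 2 + A j j) = - 1 by lra.
by field.
Qed.

(** Cholesky elimination, by induction on a bound [k] past which all rows of [A] vanish. A zero
    pivot already has a zero row by [psd_row0]; otherwise subtracting a rank-one matrix built from
    the pivot column clears the last nonzero row. *)
Lemma psd_gram A : A^T = A -> (forall x, 0 <= bform A x x) ->
  exists m (B : 'M[R]_(n, m)), A = B *m B^T.
Proof.
have [k] : exists k : nat, forall i j : 'I_n, (k <= i)%N -> A i j = 0.
  by exists n => i j; rewrite leqNgt ltn_ord.
elim: k A => [|k IHk] A A0 sA pA.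
  exists 0%N, 0; apply/matrixP => i j.
  by rewrite mul0mx A0// mxE.
case: (ltnP k n) => [kn|nk]; last first.
  by apply: IHk => // i j ki; have := leq_trans nk ki; rewrite leqNgt ltn_ord.
pose i0 := Ordinal kn.
have a_ge0 : 0 <= A i0 i0 by rewrite -bform_delta2.
have ltk (i : 'I_n) : (k <= i)%N -> i = i0 \/ (k < i)%N.
  by rewrite leq_eqVlt => /orP[/eqP ki|]; [left; exact: val_inj|right].
have [a0|an0] := eqVneq (A i0 i0) 0.
  apply: IHk => // i j /ltk[->|/A0//].
  exact: psd_row0.
have a_gt0 : 0 < A i0 i0 by rewrite lt_def an0.
set a := A i0 i0 in a_gt0 an0 *; pose u := col i0 A.
have uE x : bform A (delta_mx i0 ord0) x = (u^T *m x) ord0 ord0.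
  by rewrite bform_delta /u tr_col sA -row_mul [RHS]mxE.
have uuE x : bform (u *m u^T) x x = (u^T *m x) ord0 ord0 ^+ 2.
  rewrite /bform mulmxA -mulmxA mxE big_ord1 -{1}[x^T *m u]trmxK mxE.
  by rewrite trmx_mul trmxK.
pose A' := A - a^-1 *: (u *m u^T).
have A'E i j : A' i j = A i j - a^-1 * (A i i0 * A j i0).
  by rewrite !mxE big_ord1 !mxE.
have sA' : A'^T = A'.
  by rewrite /A' linearB/= linearZ/= trmx_mul trmxK sA.
have Asw i j : A i j = A j i by rewrite -[in LHS]sA mxE.
have [m [B' B'E]] : exists m (B : 'M[R]_(n, m)), A' = B *m B^T.
  apply: IHk => //.
    move=> i j /ltk[->|ki]; rewrite A'E; last first.
      by rewrite !(A0 i _ ki) mul0r mulr0 subrr.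
    by rewrite -/a mulrA mulVf// mul1r (Asw i0 j) subrr.
  (* Completing the square: [c] minimises the form of [A] along [x + c e_i0], and the minimum is the
     form of the Schur complement [A'] at [x], which is therefore nonnegative. *)
  move=> x; pose c := - (a^-1 * (u^T *m x) ord0 ord0).
  suff <- : bform A (x + c *: delta_mx i0 ord0) (x + c *: delta_mx i0 ord0) =
      bform A' x x by exact: pA.
  rewrite !expand_bform bform_delta2 -/a (bform_sym x) // !uE /A' bform_addm.
  have -> : bform (- (a^-1 *: (u *m u^T))) x x =
      - a^-1 * (u^T *m x) ord0 ord0 ^+ 2.
    by rewrite -uuE /bform -scaleNr -scalemxAr -scalemxAl mxE.
  by rewrite /c; set t := (u^T *m x) _ _; field.
exists (m + 1)%N, (row_mx B' (Num.sqrt a^-1 *: u)).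
rewrite tr_row_mx mul_row_col -B'E linearZ/= -scalemxAl -scalemxAr scalerA.
by rewrite -expr2 sqr_sqrtr ?invr_ge0// subrK.
Qed.

End BilinearForm.

Section PositiveDefinite.
Context {R : realType} {n : nat}.
Implicit Types (P S Q : 'M[R]_n).

Lemma PD_ge0 P x : PD R n P -> 0 <= bform P x x.
Proof.
move=> [_ pP]; have [->|x0] := eqVneq x 0; last exact/ltW/pP.
by rewrite /bform mulmx0 mxE.
Qed.

Lemma PD_unit P : PD R n P -> P \in unitmx.
Proof.
move=> [_ pP]; rewrite unitmxE unitfE; apply/negP => /det0P[v v0 vP].
have vT0 : v^T != 0 by apply: contra_neq v0 => /(congr1 trmx); rewrite trmxK trmx0.
by have := pP _ vT0; rewrite trmxK vP mul0mx mxE ltxx.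
Qed.

Lemma invmx_sym P : P^T = P -> (invmx P)^T = invmx P.
Proof. by move=> sP; rewrite trmx_inv sP. Qed.

Lemma PD_inv P : PD R n P -> PD R n (invmx P).
Proof.
move=> PP; have uP := PD_unit PP; have [sP pP] := PP.
split=> [|x x0]; first exact: invmx_sym.
have y0 : invmx P *m x != 0.
  by apply: contra_neq x0 => /(congr1 (mulmx P)); rewrite mulKVmx// mulmx0.
have := pP _ y0; rewrite trmx_mul invmx_sym// -!mulmxA.
by rewrite (mulmxA P) mulmxV// mul1mx.
Qed.

(** Writing [Q = B B^T], the trace is the squared Frobenius norm of [W = B^T v B]. So [W = 0],
    whence [Q v Q = B W B^T = 0], and [Q] cancels. *)
Lemma PD_trace_eq0 Q (v : 'M[R]_n) : PD R n Q ->
  \tr (v^T *m Q *m v *m Q) = 0 -> v = 0.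
Proof.
move=> QQ; have [sQ _] := QQ; have uQ := PD_unit QQ.
have [m [B QE]] := psd_gram sQ (fun x => PD_ge0 x QQ).
pose W := B^T *m v *m B.
have -> : \tr (v^T *m Q *m v *m Q) = \tr (W^T *m W).
  rewrite /W !trmx_mul trmxK [in LHS]QE !mulmxA [LHS]mxtrace_mulC.
  by rewrite !mulmxA.
move=> trW.
have W0 : W = 0.
  have sum0 : \sum_i \sum_j W j i ^+ 2 = 0.
    rewrite -[RHS]trW; apply: eq_bigr => i _; rewrite mxE.
    by apply: eq_bigr => j _; rewrite !mxE expr2.
  apply/matrixP => i j; rewrite [RHS]mxE; apply/eqP; rewrite -sqrf_eq0.
  have /eqP := sum0; rewrite psumr_eq0; last first.
    by move=> k _; apply: sumr_ge0 => l _; exact: sqr_ge0.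
  move=> /allP/(_ j (mem_index_enum j)) /=.
  rewrite psumr_eq0 => [|k _]; last exact: sqr_ge0.
  by move=> /allP/(_ i (mem_index_enum i)).
have : Q *m v *m Q = 0.
  by rewrite QE !mulmxA -(mulmxA B) -(mulmxA B) -/W W0 mulmx0 mul0mx.
move=> /(congr1 (fun M => invmx Q *m M *m invmx Q)).
by rewrite !mulmxA mulVmx// mul1mx mulmxK// mulmx0 mul0mx.
Qed.

(* Cauchy-Schwarz for the form [P], between [x] and [invmx P e_i]. *)
Lemma PD_coord_bound P (x : 'cV[R]_n) i : PD R n P ->
  x i ord0 ^+ 2 <= invmx P i i * bform P x x.
Proof.
move=> PP; have uP := PD_unit PP; have [sP _] := PP.
have sQ := invmx_sym sP.
pose u := invmx P *m delta_mx i ord0 : 'cV[R]_n.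
have Pux y : bform P u y = y i ord0.
  rewrite /bform /u trmx_mul sQ mulmxKV// trmx_delta -rowE.
  by rewrite mxE.
have Puu : bform P u u = invmx P i i by rewrite Pux /u -colE mxE.
have q0 : 0 < invmx P i i.
  rewrite -bform_delta2; apply: (PD_inv PP).2.
  by apply/eqP => /matrixP/(_ i ord0)/eqP; rewrite !mxE !eqxx oner_eq0.
have := PD_ge0 (x + - (x i ord0 / invmx P i i) *: u) PP.
rewrite !expand_bform (bform_sym x)// Pux Puu.
set q := invmx P i i in q0 *; set t := x i ord0; set b := bform P x x.
have -> : b + - (t / q) * t + (- (t / q) * t + - (t / q) * (- (t / q) * q)) =
  b - t ^+ 2 / q by field; rewrite gt_eqF.
by rewrite subr_ge0 ler_pdivrMr// mulrC.
Qed.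

(** With [c] the trace of [P^-1], [PD_coord_bound] gives [|x_i x_j| <= c P(x,x)]. Hence the form of
    [P - S] is smaller than that of [P], uniformly in [x], once the entries of [P - S] are small. *)
Lemma PD_near P : PD R n P ->
  \forall S \near P, forall x, x != 0 -> 0 < bform S x x.
Proof.
move=> PP; pose c := \sum_i invmx P i i.
have Qge0 i : 0 <= invmx P i i.
  by rewrite -bform_delta2; apply: PD_ge0; exact: PD_inv.
have c0 : 0 <= c by exact: sumr_ge0.
have bound (x : 'cV[R]_n) i : x i ord0 ^+ 2 <= c * bform P x x.
  apply: (le_trans (PD_coord_bound _ _ PP)); apply: ler_wpM2r; first exact: PD_ge0.
  by rewrite /c (bigD1 i)//= lerDl; exact: sumr_ge0.
(* The form of [P - S] has [n * n] terms, each at most [K^-1 c P(x,x)]; the added 1 makes the total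
   strictly less than [P(x,x)] and keeps [K] positive. *)
pose K : R := (n * n)%:R * c + 1.
have K0 : 0 < K by rewrite ltr_wpDl// mulr_ge0.
have Ki : 0 < K^-1 by rewrite invr_gt0.
near=> S => x x0; have q0 : 0 < bform P x x by exact: PP.2.
have PS : `|P - S| < K^-1.
  by near: S; apply: (@cvgr_dist_lt _ _ _ _ _ id) => //; exact: cvg_id.
have D1 : `|bform (P - S) x x| <= (n * n)%:R * (K^-1 * (c * bform P x x)).
  rewrite bform_sum; apply: (le_trans (ler_norm_sum _ _ _)).
  rewrite natrM -mulrA mulr_natl -[X in _ *+ X](card_ord n) -sumr_const.
  apply: ler_sum => i _; apply: (le_trans (ler_norm_sum _ _ _)).
  rewrite mulr_natl -[X in _ *+ X](card_ord n) -sumr_const.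
  apply: ler_sum => j _; rewrite normrM; apply: ler_pM => //.
    apply: le_trans (ltW PS).
    rewrite [leRHS]/Num.Def.normr/= mx_normrE; exact: (le_bigmax _ _ (i, j)).
  have bi := bound x i; have bj := bound x j.
  have h1 := sqr_ge0 (x i ord0 - x j ord0).
  have h2 := sqr_ge0 (x i ord0 + x j ord0).
  by rewrite ler_norml; nra.
have D2 : bform (P - S) x x < bform P x x.
  apply: (le_lt_trans (ler_norm _)); apply: (le_lt_trans D1).
  rewrite !mulrA -[ltRHS]mul1r ltr_pM2r// mulrAC ltr_pdivrMr// mul1r /K.
  by rewrite ltrDl.
move: D2; rewrite bform_addm gtrDl.
by rewrite /bform mulmxN mulNmx mxE oppr_lt0.
Unshelve. all: by end_near. Qed.

Lemma PD_near_sym P : PD R n P -> \forall S \near P, Sym2 R n S -> PD R n S.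
Proof. by move=> /PD_near; apply: filterS => S pS sS; split. Qed.

Lemma PD_open : open_in (Sym2 R n) (PD R n).
Proof.
exists [set S | forall x, x != 0 -> 0 < bform S x x]^°; first exact: open_interior.
apply/seteqP; split=> S; first by move=> PS; split; [exact: PD_near|exact: PS.1].
by move=> [/interior_subset pS sS].
Qed.

End PositiveDefinite.

(** * The mixed coordinates and their local inverse *)

(** Meant for [a] a difference of values and [b] the difference of arguments: a map whose deviation
    from the identity is 1/2-Lipschitz is injective, with 2-Lipschitz inverse. *)
Lemma expansive_bound (R : realType) (V : normedModType R) (a b : V) :
  `|a - b| <= `|b| / 2 -> `|b| <= 2 * `|a|.
Proof.
move=> h; have := ler_distD a b 0; rewrite !subr0 distrC => h'.
by lra.
Qed.

(** Solutions of [F x = y] are the fixed points of [x - F x + y]. This map is a 1/2-contraction on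
    the closed ball and moves the centre by at most [r / 2], so it preserves the ball. *)
Lemma near_identity_onto (R : realType) (V : completeNormedModType R)
    (F : V -> V) (P : V) (r : R) (y : V) : 0 <= r ->
  (forall a b, `|P - a| <= r -> `|P - b| <= r ->
     `|F a - F b - (a - b)| <= `|a - b| / 2) ->
  `|F P - y| <= r / 2 -> exists2 a, `|P - a| <= r & F a = y.
Proof.
move=> r0 Fid yr; pose D := closed_ball_ Num.Def.normr P r.
pose T x := x - F x + y.
have DP : D P by rewrite /D /closed_ball_/= subrr normr0.
have Tlip a b : D a -> D b -> `|T a - T b| <= `|a - b| / 2.
  move=> Da Db; suff -> : T a - T b = (a - b) - (F a - F b).
    by rewrite distrC; exact: Fid.
  by rewrite /T opprD addrACA subrr addr0 opprD addrACA -opprD.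
have TD : {homo T : x / D x >-> D x}.
  move=> a Da; have h1 := Tlip P a DP Da.
  have h2 : `|P - T P| <= r / 2.
    by rewrite /T opprD addrA opprB addrCA subrr addr0.
  have h3 := ler_distD (T P) P (T a).
  by rewrite /D /closed_ball_/= in Da *; lra.
have [|||a Da Ta] := @banach_fixed_point R V D (mkfun_fun TD).
- exists (2^-1)%:nng; split; first by rewrite /= invf_lt1 // ltr1n.
  by move=> [a b] [/= Da Db]; rewrite mulrC; exact: Tlip.
- exact: closed_closed_ball_.
- by exists P.
exists a => //; move/eqP: Ta; rewrite /= /mkfun /T -subr_eq0 opprD opprB addrA.
by rewrite addrCA subrr addr0 subr_eq0 => /eqP.
Qed.

(* Registers the missing join: matrices form a [completeNormedModType]. *)
HB.instance Definition _ (R : realType) (m n : nat) :=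
  Complete.on 'M[R]_(m, n).

Section MixedMap.
Context {R : realType} {n : nat}.
Variable C : rel 'I_n.
Implicit Types (A S T D P : 'M[R]_n).

(* The differential at [S] of [mixed_map] below is [mixed_diff S S]; using
   different [S] and [T] gives its exact difference quotients. *)
Definition mixed_diff S T D : 'M[R]_n :=
  \matrix_(i, j) if C i j then (invmx S *m D *m invmx T) i j else D i j.

(** The minus sign absorbs the one in [S^-1 - T^-1 = - S^-1 (S - T) T^-1], so that differences are
    given by [mixed_diff] without signs. *)
Definition mixed_map S : 'M[R]_n :=
  \matrix_(i, j) if C i j then - invmx S i j else S i j.

Fact mixed_diff_is_linear S T : linear (mixed_diff S T).
Proof.
move=> a A B; apply/matrixP => i j; rewrite [LHS]mxE [RHS]mxE.
rewrite [X in _ = X + _]mxE ![mixed_diff _ _ _ _ _]mxE.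
case: ifP => _; last by rewrite !mxE.
by rewrite mulmxDr mulmxDl -scalemxAr -scalemxAl mxE [X in X + _]mxE.
Qed.

HB.instance Definition _ S T :=
  GRing.isLinear.Build R 'M[R]_n 'M[R]_n _ (mixed_diff S T)
    (mixed_diff_is_linear S T).

Lemma mixed_map_sub S T : S \in unitmx -> T \in unitmx ->
  mixed_map S - mixed_map T = mixed_diff S T (S - T).
Proof.
move=> uS uT; apply/matrixP => i j; rewrite [LHS]mxE.
rewrite [X in _ + X = _]mxE ![mixed_map _ i j]mxE [RHS]mxE.
case: ifP => _; last by rewrite !mxE.
rewrite mulmxBr mulVmx// mulmxBl mul1mx mulmxK//.
by rewrite [RHS]mxE [X in _ = _ + X]mxE opprK addrC.
Qed.

(** The inverse of [mixed_diff S T], meaningful where its matrix is invertible. Going through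
    [invmx] of that matrix makes it visibly rational in [S] and [T]. *)
Definition mixed_solve S T v : 'M[R]_n :=
  vec_mx (mxvec v *m invmx (lin_mx (mixed_diff S T))).

Lemma mixed_solveK S T D : lin_mx (mixed_diff S T) \in unitmx ->
  mixed_solve S T (mixed_diff S T D) = D.
Proof. by move=> u; rewrite /mixed_solve -mul_vec_lin/= mulmxK// mxvecK. Qed.

Lemma mixed_diffK S T v : lin_mx (mixed_diff S T) \in unitmx ->
  mixed_diff S T (mixed_solve S T v) = v.
Proof.
move=> u; apply: (can_inj (@mxvecK _ _ _)).
by rewrite -mul_vec_lin /mixed_solve vec_mxK mulmxKV.
Qed.

Lemma mixed_solveB S T v w :
  mixed_solve S T (v - w) = mixed_solve S T v - mixed_solve S T w.
Proof. by rewrite /mixed_solve linearB/= mulmxBl linearB. Qed.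

Lemma mixed_solveZ S T a v : mixed_solve S T (a *: v) = a *: mixed_solve S T v.
Proof. by rewrite /mixed_solve linearZ/= -scalemxAl linearZ. Qed.

Lemma mixed_diff_unit S T : (forall D, mixed_diff S T D = 0 -> D = 0) ->
  lin_mx (mixed_diff S T) \in unitmx.
Proof.
move=> inj; rewrite unitmxE unitfE; apply/negP => /det0P[v v0].
rewrite -[v]vec_mxK mul_vec_lin => /(congr1 vec_mx).
rewrite mxvecK linear0 => /inj v00; move: v0.
by rewrite -[v]vec_mxK v00 linear0 eqxx.
Qed.

End MixedMap.

(** * Norm estimates and continuity of matrix inversion *)

Section MatrixNorm.
Context {R : realType}.

Lemma le_mx_entry m n (A : 'M[R]_(m, n)) i j : `|A i j| <= `|A|.
Proof.
by rewrite [leRHS]/Num.Def.normr/= mx_normrE; exact: (le_bigmax _ _ (i, j)).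
Qed.

Lemma mx_norm_le m n (A : 'M[R]_(m, n)) (e : R) : 0 <= e ->
  (forall i j, `|A i j| <= e) -> `|A| <= e.
Proof.
move=> e0 Ae; rewrite /Num.Def.normr/= mx_normrE.
by apply: bigmax_le => // -[i j] _; exact: Ae.
Qed.

Lemma mx_norm_mul m n p (A : 'M[R]_(m, n)) (B : 'M[R]_(n, p)) :
  `|A *m B| <= n%:R * (`|A| * `|B|).
Proof.
apply: mx_norm_le => [|i j]; first by rewrite !mulr_ge0.
rewrite mxE (le_trans (ler_norm_sum _ _ _))// mulr_natl.
rewrite -[X in _ *+ X](card_ord n) -sumr_const.
by apply: ler_sum => k _; rewrite normrM ler_pM// le_mx_entry.
Qed.

Lemma mx_norm_tr m n (A : 'M[R]_(m, n)) : `|A^T| = `|A|.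
Proof.
apply/eqP; rewrite eq_le; apply/andP; split; apply: mx_norm_le => // i j.
  by rewrite mxE le_mx_entry.
by rewrite -[A]trmxK [_ i j]mxE trmxK le_mx_entry.
Qed.

Lemma norm_mixed_solve n C (P v : 'M[R]_n) :
  `|mixed_solve C P P v| <=
    (n * n)%:R * `|invmx (lin_mx (mixed_diff C P P))| * `|v|.
Proof.
apply: mx_norm_le => [|i j]; first by rewrite !mulr_ge0.
rewrite mxE (le_trans (le_mx_entry _ _ _))// (le_trans (mx_norm_mul _ _))//.
rewrite -mulrA ler_wpM2l// mulrC ler_wpM2l//.
by apply: mx_norm_le => // k l; rewrite ord1; case/mxvec_indexP: l => ? ?;
  rewrite mxvecE le_mx_entry.
Qed.

Lemma open_unitmx n : open [set S : 'M[R]_n | S \in unitmx].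
Proof.
have -> : [set S : 'M[R]_n | S \in unitmx] =
    (fun S : 'M[R]_n => \det S) @^-1` [set x | x != 0].
  by apply/seteqP; split=> S /=; rewrite unitmxE unitfE.
apply: open_comp; last exact: open_neq.
move=> S _; apply: (rational_in_continuous openT
  (coordinates_differential setT)) => //.
by apply: rational_det => i j; apply: rat_gen; exists i, j.
Qed.

Lemma rational_coordinates n (U : set 'M[R]_n) :
  rational_mx (@coordinates R n) U id.
Proof. by move=> i j; apply: rat_gen; exists i, j. Qed.

Lemma invmx_near n (P : 'M[R]_n) (e : R) : P \in unitmx -> 0 < e ->
  \forall S \near P, S \in unitmx /\ `|invmx P - invmx S| < e.
Proof.
move=> uP e0; near=> S; split.
  by near: S; exact: (open_nbhs_nbhs (conj (@open_unitmx n) uP)).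
near: S; apply: cvgr_dist_lt => //.
apply: (rational_mx_continuous (@open_unitmx n)
  (coordinates_differential _)) => //.
by apply: rational_invmx => //; exact: rational_coordinates.
Unshelve. all: by end_near. Qed.

End MatrixNorm.

(** * Inverse function theorem for the mixed coordinates *)

Section LocalInverse.
Context {R : realType} {n : nat}.
Variable C : rel 'I_n.
Implicit Types (S T D P : 'M[R]_n).

Local Notation J := (mixed_diff C).
Local Notation f := (mixed_map C).
Local Notation Jinv := (mixed_solve C).

Lemma mixed_diff_near P (e : R) : P \in unitmx -> 0 < e ->
  exists2 r : R, 0 < r & forall S T, `|P - S| <= r -> `|P - T| <= r ->
    [/\ S \in unitmx, T \in unitmx & forall D, `|J S T D - J P P D| <= e * `|D|].
Proof.
move=> uP e0; pose q := `|invmx P|; have q0 : 0 <= q by exact: normr_ge0.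
pose N : R := n%:R; have N0 : 0 <= N by exact: ler0n.
(* If [S^-1] and [T^-1] are within [h <= 1] of [P^-1], then [T^-1] has norm at most [q + 1], and the
   two terms of the splitting of [A - B] below add up to at most [N^2 (q + 1) h + N^2 q h = N^2 (2 q
   + 1) h <= e] times the norm of [D]. *)
pose h := Num.min 1 (e / (N * N * (2 * q + 1) + 1)).
have K0 : 0 < N * N * (2 * q + 1) + 1 by rewrite ltr_wpDl// !mulr_ge0// addr_ge0// mulr_ge0.
have h0 : 0 < h by rewrite lt_min ltr01 divr_gt0.
have h1 : h <= 1 by rewrite ge_min lexx.
have he : N * N * (2 * q + 1) * h <= e.
  have : h <= e / (N * N * (2 * q + 1) + 1) by rewrite ge_min lexx orbT.
  by rewrite ler_pdivlMr//; nra.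
have /nbhs_normP[s /= s0 Ps] := invmx_near uP h0.
have near S : `|P - S| <= s / 2 -> S \in unitmx /\ `|invmx P - invmx S| < h.
  by move=> PS; apply: Ps; rewrite /ball_/=; lra.
exists (s / 2) => [|S T /near[uS hS] /near[uT hT]]; first lra.
split=> // D.
have qT : `|invmx T| <= q + 1.
  by have := ler_distD (invmx P) (invmx T) 0; rewrite !subr0 distrC -/q; lra.
apply: mx_norm_le => [|i j]; first by rewrite mulr_ge0// ltW.
rewrite [X in `|X|]mxE [X in _ + X]mxE ![mixed_diff _ _ _ _ _ _]mxE.
case: ifP => _; last by rewrite subrr normr0 mulr_ge0// ltW.
set A := invmx S *m D *m invmx T; set B := invmx P *m D *m invmx P.
have -> : A i j - B i j = (A - B) i j by rewrite [RHS]mxE [X in _ = _ + X]mxE.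
apply: (le_trans (le_mx_entry _ _ _)).
have -> : A - B = (invmx S - invmx P) *m (D *m invmx T)
    + invmx P *m (D *m (invmx T - invmx P)).
  rewrite mulmxBl !mulmxBr !mulmxA addrA subrK //.
have b1 := mx_norm_mul (invmx S - invmx P) (D *m invmx T).
have b2 := mx_norm_mul D (invmx T).
have b3 := mx_norm_mul (invmx P) (D *m (invmx T - invmx P)).
have b4 := mx_norm_mul D (invmx T - invmx P).
rewrite distrC in hS; rewrite distrC in hT.
apply: (le_trans (ler_normD _ _)).
move: b1 b2 b3 b4 hS hT qT; rewrite -/q -/N.
set x1 := `|_ *m (_ *m invmx T)|; set x2 := `|D *m invmx T|.
set x3 := `|invmx P *m _|; set x4 := `|D *m _|.
set hs := `|invmx S - _|; set ht := `|invmx T - _|; set t := `|invmx T|.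
set d := `|D|.
have [hs0 ht0 t0 d0] : [/\ 0 <= hs, 0 <= ht, 0 <= t & 0 <= d] by split; exact: normr_ge0.
have [x20 x40] : 0 <= x2 /\ 0 <= x4 by split; exact: normr_ge0.
move=> b1 b2 b3 b4 hS hT qT.
have c2 : x2 <= N * (d * (q + 1)).
  by apply: (le_trans b2); rewrite ler_wpM2l// ler_wpM2l.
have c4 : x4 <= N * (d * h).
  by apply: (le_trans b4); rewrite ler_wpM2l// ler_wpM2l// ltW.
have c1 : x1 <= N * (h * (N * (d * (q + 1)))).
  by apply: (le_trans b1); rewrite ler_wpM2l// ler_pM// ltW.
have c3 : x3 <= N * (q * (N * (d * h))).
  by apply: (le_trans b3); rewrite ler_wpM2l// ler_wpM2l.
have c : N * N * (2 * q + 1) * h * d <= e * d by rewrite ler_wpM2r.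
by lra.
Qed.

Lemma rational_mixed_diff (V : normedModType R) (B : set (V -> R)) (U : set V)
    (F G : V -> 'M[R]_n) :
  (forall x, U x -> F x \in unitmx) -> (forall x, U x -> G x \in unitmx) ->
  rational_mx B U F -> rational_mx B U G ->
  rational_mx B U (fun x => lin_mx (J (F x) (G x))).
Proof.
move=> uF uG rF rG i j; case/mxvec_indexP: j => k l.
(* Row [i] of the matrix of a linear map is the image of the [i]-th basis matrix. *)
pose E : 'M[R]_n := vec_mx (delta_mx 0 i).
have r : rational_in B U (fun x => J (F x) (G x) E k l).
  have [Ckl|Ckl] := boolP (C k l); last first.
    by apply: rat_ext (rat_cst _ _ (E k l)) => x _; rewrite [RHS]mxE (negbTE Ckl).
  have rM : rational_mx B U (fun x => invmx (F x) *m E *m invmx (G x)).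
    apply: rational_mxM; last exact: rational_invmx.
    by apply: rational_mxM; [exact: rational_invmx|exact: rational_mx_cst].
  by apply: rat_ext (rM k l) => x _; rewrite [RHS]mxE Ckl.
by apply: rat_ext r => x _; rewrite [RHS]mxE /= mxvecE.
Qed.

Lemma rational_mixed_solve (V : normedModType R) (B : set (V -> R)) (U : set V)
    (F G : V -> 'M[R]_n) v :
  (forall x, U x -> F x \in unitmx) -> (forall x, U x -> G x \in unitmx) ->
  (forall x, U x -> lin_mx (J (F x) (G x)) \in unitmx) ->
  rational_mx B U F -> rational_mx B U G ->
  rational_mx B U (fun x => Jinv (F x) (G x) v).
Proof.
move=> uF uG uJ rF rG i j.
have rM : rational_mx B U (fun x => mxvec v *m invmx (lin_mx (J (F x) (G x)))).
  apply: rational_mxM; first exact: rational_mx_cst.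
  by apply: rational_invmx => //; exact: rational_mixed_diff.
by apply: rat_ext (rM 0 (mxvec_index i j)) => x _; rewrite [RHS]mxE.
Qed.

Lemma mixed_map_smooth (U : set 'M[R]_n) :
  open U -> (forall S, U S -> S \in unitmx) -> smooth_on setT U f.
Proof.
move=> oU uU; apply: (rational_mx_smooth oU (coordinates_differential U)).
move=> i j; have rid := rational_coordinates U.
have [Cij|Cij] := boolP (C i j); last first.
  by apply: rat_ext (rid i j) => x _; rewrite [RHS]mxE (negbTE Cij).
have r := rat_mul (rat_cst _ _ (-1)) (rational_invmx uU rid i j).
by apply: rat_ext r => x _; rewrite [RHS]mxE Cij mulN1r.
Qed.

(** After composition with the inverse differential at [P], the map is close to the identity on a
    ball, hence injective there and onto a neighbourhood. The local inverse [g] has derivative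
    [Jinv (g y) (g y) v], rational in the entries of [g], which gives smoothness. *)
Lemma mixed_local_inverse P (N : set 'M[R]_n) :
  P \in unitmx -> (forall D, J P P D = 0 -> D = 0) -> nbhs P N ->
  exists (r : R) (W : set 'M[R]_n) (g : 'M[R]_n -> 'M[R]_n),
    let b := [set S | `|P - S| < r] in
    [/\ 0 < r, b `<=` N `&` [set S | S \in unitmx], open W, W (f P) &
     [/\ forall S T, b S -> b T -> f S = f T -> S = T,
         forall y, W y -> b (g y) /\ f (g y) = y &
         smooth_on setT W g]].
Proof.
move=> uP inj /nbhs_normP[s /= s0 sN].
have uJ := mixed_diff_unit inj.
pose c := (n * n)%:R * `|invmx (lin_mx (J P P))|.
have c0 : 0 <= c by rewrite mulr_ge0.
have bJ v : `|Jinv P P v| <= c * `|v| by exact: norm_mixed_solve.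
(* The inverse differential has norm at most [c], so this tolerance leaves an error factor
   [c / (2 (c + 1)) <= 1/2] after normalisation; the added 1 covers [c = 0]. *)
have e0 : 0 < (2 * (c + 1))^-1 by rewrite invr_gt0 mulr_gt0// ltr_wpDl.
have [r0 r00 rP] := mixed_diff_near uP e0.
pose r := Num.min r0 (s / 2).
have r_gt0 : 0 < r by rewrite lt_min r00/= divr_gt0.
have rr0 : r <= r0 by rewrite ge_min lexx.
have rs : r < s by rewrite gt_min; apply/orP; right; lra.
have near S T : `|P - S| <= r -> `|P - T| <= r ->
    [/\ S \in unitmx, T \in unitmx &
        forall D, `|Jinv P P (J S T D) - D| <= `|D| / 2].
  move=> PS PT; have [//||uS uT h] := rP S T; [exact: le_trans rr0..|].
  split=> // D; rewrite -{2}(mixed_solveK D uJ) -mixed_solveB.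
  apply: (le_trans (bJ _)); apply: (@le_trans _ _ (c * ((2 * (c + 1))^-1 * `|D|))).
    by rewrite ler_wpM2l.
  rewrite mulrA mulrC ler_wpM2l// ler_pdivrMr ?mulr_gt0 ?ltr_wpDl//.
  by lra.
(* [Jinv P P (J S T D)] is within half the norm of [D] from [D], so [J S T D = 0] forces [D = 0]. *)
have uJr S T : `|P - S| <= r -> `|P - T| <= r -> lin_mx (J S T) \in unitmx.
  move=> PS PT; have [_ _ h] := near _ _ PS PT.
  apply: mixed_diff_unit => D JD; apply/eqP; rewrite -normr_eq0.
  have := h D; rewrite JD (_ : Jinv P P 0 = 0) ?sub0r ?normrN; last first.
    by rewrite -[X in Jinv P P X](scale0r 0) mixed_solveZ scale0r.
  by have := normr_ge0 D; rewrite eq_le; lra.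
pose F S := Jinv P P (f S).
have Fid S T : `|P - S| <= r -> `|P - T| <= r ->
    `|F S - F T - (S - T)| <= `|S - T| / 2.
  move=> PS PT; have [uS uT h] := near _ _ PS PT.
  by rewrite /F -mixed_solveB mixed_map_sub//; exact: h.
have Fexp S T : `|P - S| <= r -> `|P - T| <= r -> `|S - T| <= 2 * `|F S - F T|.
  by move=> PS PT; apply: expansive_bound; exact: Fid.
have PP : `|P - P| <= r by rewrite subrr normr0 ltW.
(* The radius [r / 2] serves twice: it allows [near_identity_onto], and with the factor 2 of [Fexp]
   it puts the preimage in the open ball of radius [r]. *)
pose W := [set y | `|F P - Jinv P P y| < r / 2].
have onto y : W y -> exists S, `|P - S| < r /\ f S = y.
  move=> Wy; have [S PS FS] := @near_identity_onto R 'M[R]_n F P r _ (ltW r_gt0) Fid (ltW Wy).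
  exists S; split; last by rewrite -(mixed_diffK (f S) uJ) -/(F S) FS mixed_diffK.
  by apply: (le_lt_trans (Fexp _ _ PP PS)); rewrite FS; move: Wy; rewrite /W/=; lra.
pose g y := xget P [set S | `|P - S| < r /\ f S = y].
have gP y : W y -> `|P - g y| < r /\ f (g y) = y.
  by move=> /onto hy; apply: (xgetPex P hy).
have oW : open W.
  pose h := Jinv P P; have hl : linear h.
    move=> a v w; rewrite -[w in LHS]opprK /h mixed_solveB mixed_solveZ.
    by congr (_ + _); rewrite -[- w]scaleN1r mixed_solveZ scaleN1r opprK.
  rewrite (_ : W = h @^-1` [set x | `|F P - x| < r / 2])//.
  apply: open_comp.
    move=> y _; apply: (rational_mx_continuous openT
      (coordinates_differential setT)) => //.
    move=> i j; have rM : rational_mx (@coordinates R n) setT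
        (fun v => vec_mx (mxvec v *m invmx (lin_mx (J P P)))).
      move=> k l; have rv : rational_mx (@coordinates R n) setT
          (fun v => mxvec v *m invmx (lin_mx (J P P))).
        apply: rational_mxM; last exact: rational_mx_cst.
        move=> a b; rewrite ord1; case/mxvec_indexP: b => a' b'.
        by apply: rat_ext (rational_coordinates setT a' b') => x _; rewrite mxvecE.
      by apply: rat_ext (rv 0 (mxvec_index k l)) => x _; rewrite [RHS]mxE.
    exact: rM.
  by have := @ball_open R _ (F P) (r / 2); rewrite -ball_normE; apply; rewrite divr_gt0.
exists r, W, g; split=> //.
- move=> S PS; split; last by have [] := near S S (ltW PS) (ltW PS).
  by apply: sN; rewrite /ball_/=; exact: lt_trans rs.
- by rewrite /W/= subrr normr0 divr_gt0.
split=> //.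
  move=> S T PS PT fST; apply/eqP; rewrite -subr_eq0 -normr_eq0.
  have := Fexp _ _ (ltW PS) (ltW PT); rewrite /F fST subrr normr0 mulr0.
  by have := normr_ge0 (S - T); rewrite eq_le => -> ->.
(* Taking the entries of [g] themselves as generators makes [g] trivially rational; what remains is
   that their derivatives are rational in them. *)
pose Bg := [set h : 'M[R]_n -> R | exists i j, h = fun y => g y i j].
have rg : rational_mx Bg W g by move=> i j; apply: rat_gen; exists i, j.
have glip y z : W y -> W z -> `|g y - g z| <= 2 * (c * `|y - z|).
  move=> Wy Wz; have [gy fgy] := gP y Wy; have [gz fgz] := gP z Wz.
  apply: (le_trans (Fexp _ _ (ltW gy) (ltW gz))).
  by rewrite ler_wpM2l// /F -mixed_solveB fgy fgz.
have gcont y : W y -> {for y, continuous g}.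
  move=> Wy; apply/(@cvgrPdist_lt _ _ _ (nbhs y)) => e egt0.
  have k0 : 0 < 2 * c + 1 by rewrite ltr_wpDl// mulr_ge0.
  have ek0 : 0 < e / (2 * c + 1) by exact: divr_gt0.
  near=> z.
  have Wz : W z by near: z; exact: (open_nbhs_nbhs (conj oW Wy)).
  apply: (le_lt_trans (glip _ _ Wy Wz)).
  have yz : `|y - z| < e / (2 * c + 1).
    near: z; apply: (@cvgr_dist_lt _ _ _ _ _ id) => //; exact: cvg_id.
  rewrite ltr_pdivlMr// in yz; have := normr_ge0 (y - z); nra.
have ug y : W y -> g y \in unitmx.
  by move=> /gP[gy _]; have [] := near _ _ (ltW gy) (ltW gy).
suff dg : differential_generators Bg W by exact: (rational_mx_smooth oW dg).
(* By [mixed_map_sub] the difference quotient of [g] is exactly [Jinv (g (y + h v)) (g y) v]; the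
   limit follows from continuity of [g] and of [Jinv] in its first argument. *)
have gder y v : W y -> is_derive y v g (Jinv (g y) (g y) v).
  move=> Wy; have [gy fgy] := gP y Wy.
  suff lim : h^-1 *: ((g \o shift y) (h *: v) - g y) @[h --> (0 : R)^'] -->
      Jinv (g y) (g y) v.
    apply: DeriveDef; first by apply/cvg_ex; exists (Jinv (g y) (g y) v).
    exact/cvg_lim.
  have shift_cvg : (shift y) (h *: v) @[h --> (0 : R)^'] --> y.
    rewrite -[X in _ --> X](add0r y) -[X in _ --> X + _](scale0r v).
    apply: cvg_within_filter; apply: cvgD; last exact: cvg_cst.
    by apply: cvgZr_tmp; exact: cvg_id.
  have bopen : open [set S : 'M[R]_n | `|P - S| < r].
    by have := @ball_open R _ P r; rewrite -ball_normE; apply.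
  have solve_cvg : Jinv (g (shift y (h *: v))) (g y) v @[h --> (0 : R)^'] -->
      Jinv (g y) (g y) v.
    apply: (@cvg_comp _ _ _ (fun h => g (shift y (h *: v)))
      (fun S => Jinv S (g y) v) _ (nbhs (g y))).
      by apply: (cvg_comp _ _ shift_cvg); exact: gcont.
    suff solve_cont : {for g y, continuous (fun S => Jinv S (g y) v)} by [].
    apply: (rational_mx_continuous bopen (coordinates_differential _)) => //.
    apply: (@rational_mixed_solve _ _ _ id (fun=> g y)).
    - by move=> S PS; have [] := near _ _ (ltW PS) (ltW PS).
    - by move=> S _; exact: ug.
    - by move=> S PS; apply: uJr; exact: ltW.
    - exact: rational_coordinates.
    - exact: rational_mx_cst.
  apply: cvg_trans solve_cvg; apply: near_eq_cvg; near=> h.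
  have h0 : h != 0 by near: h; exact: nbhs_dnbhs_neq.
  have Wh : W (shift y (h *: v)).
    by near: h; exact: (shift_cvg W (open_nbhs_nbhs (conj oW Wy))).
  have [gh fgh] := gP _ Wh; have [uh uy _] := near _ _ (ltW gh) (ltW gy).
  have E : mixed_diff C (g (shift y (h *: v))) (g y)
      (g (shift y (h *: v)) - g y) = h *: v.
    by rewrite -mixed_map_sub// fgh fgy /= addrK.
  rewrite /comp -[X in _ = _ *: X](mixed_solveK _ (uJr _ _ (ltW gh) (ltW gy))) E.
  by rewrite mixed_solveZ scalerA mulVf// scale1r.
move=> _ [i [j ->]]; split.
  move=> y Wy; apply: (@cvg_comp _ _ _ g (fun S : 'M[R]_n => S i j)).
    exact: gcont.
  exact: coord_continuous.
move=> v; exists (fun y => Jinv (g y) (g y) v i j).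
  apply: (@rational_mixed_solve _ _ _ g g) => //.
  by move=> y /gP[gy _]; apply: uJr; exact: ltW.
move=> y Wy; have [dgy vgy] := gder y v Wy.
apply: DeriveDef; first by have /derivable_mxP := dgy; apply.
have := derive_mx dgy; rewrite vgy => /matrixP/(_ i j).
by rewrite [RHS]mxE => <-.
Unshelve. all: by end_near. Qed.

End LocalInverse.

(** * Charts and tangent spaces *)

(** With [Q = P^-1], the trace of [D^T Q D Q] is the sum of the products [D_ji (Q D Q)_ji]. Each has
    a zero factor: the second on [C], the first off [C]. *)
Lemma mixed_diff_inj (R : realType) n (C : rel 'I_n) (P D : 'M[R]_n) :
  PD R n P -> mixed_diff C P P D = 0 -> D = 0.
Proof.
move=> PP JD; apply: (PD_trace_eq0 (PD_inv PP)).
rewrite -!mulmxA /mxtrace big1// => i _; rewrite mxE big1// => j _.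
have : mixed_diff C P P D j i = 0 by rewrite JD mxE.
rewrite mxE -mulmxA [D^T i j]mxE.
by case: ifP => _; [move=> ->; rewrite mulr0|move=> ->; rewrite mul0r].
Qed.

(** Equivariance under transposition lets a chart built on all matrices restrict to the symmetric
    ones. *)
Lemma mixed_map_tr (R : realType) n (C : rel 'I_n) (S : 'M[R]_n) :
  symmetric C -> mixed_map C S^T = (mixed_map C S)^T.
Proof.
move=> sC; apply/matrixP => i j; rewrite [RHS]mxE ![mixed_map _ _ _ _]mxE.
by rewrite (sC i j) -trmx_inv !mxE.
Qed.

Lemma mixed_diff_tr (R : realType) n (C : rel 'I_n) (S D : 'M[R]_n) :
  symmetric C -> S^T = S -> mixed_diff C S S D^T = (mixed_diff C S S D)^T.
Proof.
move=> sC sS; apply/matrixP => i j; rewrite [RHS]mxE ![mixed_diff _ _ _ _ _ _]mxE.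
rewrite (sC i j) [D^T i j]mxE; case: ifP => // _.
have -> : invmx S *m D^T *m invmx S = (invmx S *m D *m invmx S)^T.
  by rewrite !trmx_mul invmx_sym// mulmxA.
by rewrite mxE.
Qed.

(** * Submanifolds cut out by vanishing entries *)

Section PatternSpace.
Context {R : realType} {n : nat}.
Variable Z : rel 'I_n.

Definition pattern_part (v : 'M[R]_n) : 'M[R]_n :=
  \matrix_(i, j) if Z i j then v i j else 0.

Fact pattern_part_is_linear : linear pattern_part.
Proof.
by move=> a v w; apply/matrixP => i j; rewrite !mxE; case: ifP => // _;
  rewrite mulr0 addr0.
Qed.

HB.instance Definition _ :=
  GRing.isLinear.Build R 'M[R]_n 'M[R]_n _ pattern_part pattern_part_is_linear.

Definition pattern_space : {vspace 'M[R]_n} :=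
  (lker (linfun pattern_part) :&: lker (linfun trmx - \1%VF)%R)%VS.

Lemma pattern_spaceP v : v \in pattern_space <->
  v^T = v /\ forall i j, Z i j -> v i j = 0.
Proof.
rewrite memv_cap !memv_ker add_lfunE opp_lfunE id_lfunE !lfunE /= subr_eq0.
split=> [/andP[/eqP v0 /eqP vT]|[vT v0]].
  split=> // i j Zij; have := congr1 (fun M : 'M[R]_n => M i j) v0.
  by rewrite !mxE Zij.
rewrite vT eqxx andbT; apply/eqP/matrixP => i j; rewrite !mxE.
by case: ifP => // /v0.
Qed.

End PatternSpace.

(** Common reduction for the three submanifold claims. The zero pattern [Z] is the same at all
    points, so all charts share one model space and the dimension is constant. *)
Lemma pattern_submanifold (R : realType) n (Z : rel 'I_n) (A : set 'M[R]_n) :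
  A `<=` PD R n ->
  (forall P, A P -> exists (U W : set 'M[R]_n) (f g : 'M[R]_n -> 'M[R]_n),
    [/\ U P, U `<=` PD R n, diffeomorphism (Sym2 R n) U W f g &
        forall S, U S -> A S <-> forall i j, Z i j -> f S i j = 0]) ->
  smooth_submanifold (Sym2 R n) (PD R n) A.
Proof.
move=> APD chart; split=> //; exists (\dim (@pattern_space R n Z)) => P AP.
have [U [W [f [g [UP UPD fg AU]]]]] := chart P AP.
exists U, W, f, g, (pattern_space Z); have [_ oW fUW _ _] := fg; have [N _ WN] := oW.
split=> //; first by split=> // v /= /pattern_spaceP[].
apply/seteqP; split=> y.
  move=> [S [AS US] <-]; have Wf : W (f S) by rewrite -fUW; exists S.
  split=> //; apply/pattern_spaceP; split; last exact/(AU S US).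
  by move: Wf; rewrite WN => -[].
move=> [/= /pattern_spaceP[_ y0] Wy]; move: (Wy); rewrite -{1}fUW => -[S US fS].
by exists S => //; split=> //; apply/(AU S US); rewrite fS.
Qed.

(** * Charts for the two models and their intersection *)

Section Charts.
Context {R : realType} {n : nat}.
Implicit Types (G H : sgraph n) (P S : 'M[R]_n).

Definition nonedge G : rel 'I_n := fun i j => (i != j) && ~~ G i j.

Lemma nonedge_sym G : symmetric (nonedge G).
Proof. by move=> i j; rewrite /nonedge eq_sym edge_sym. Qed.

(** Completeness of the union enters the proof only through this disjointness of the two sets of
    non-edges. *)
Lemma nonedge_complete G H i j : is_complete (graph_union G H) ->
  nonedge H i j -> nonedge G i j = false.
Proof.
move=> GH /andP[ij Hij]; have := GH i j ij.
by rewrite /= /graph_union_rel (negbTE Hij) orbF /nonedge => ->; rewrite andbF.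
Qed.

Lemma modelP G S : model R G S <->
  PD R n S /\ forall i j, nonedge G i j -> invmx S i j = 0.
Proof.
split=> -[PS S0]; split=> // i j; first by move=> /andP[]; exact: S0.
by move=> ij Gij; apply: S0; rewrite /nonedge ij.
Qed.

Lemma model_invP H S : model_inv R H S <->
  PD R n S /\ forall i j, nonedge H i j -> S i j = 0.
Proof.
split=> [[T /modelP[PT T0] <-]|[PS S0]]; first by split=> //; exact: PD_inv.
exists (invmx S); last by rewrite invmxK.
by apply/modelP; split=> [|i j /S0]; [exact: PD_inv|rewrite invmxK].
Qed.

Lemma diffeo_id : diffeomorphism (Sym2 R n) (PD R n) (PD R n) id id.
Proof.
have sm : smooth_on (Sym2 R n) (PD R n) (id : 'M[R]_n -> 'M[R]_n).
  apply: (@smooth_on_sub _ _ _ setT _ setT) => //.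
  apply: (rational_mx_smooth openT (coordinates_differential setT)).
  exact: rational_coordinates.
by split=> //; [exact: PD_open|exact: PD_open|rewrite image_id].
Qed.

Lemma diffeo_invmx : diffeomorphism (Sym2 R n) (PD R n) (PD R n) invmx invmx.
Proof.
have sm : smooth_on (Sym2 R n) (PD R n) (invmx : 'M[R]_n -> 'M[R]_n).
  apply: (@smooth_on_sub _ _ _ setT _ [set S | S \in unitmx]) => //.
    by move=> S /PD_unit.
  apply: (rational_mx_smooth (@open_unitmx R n) (coordinates_differential _)).
  by apply: rational_invmx => //; exact: rational_coordinates.
split=> //; [exact: PD_open|exact: PD_open| |by move=> S _; exact: invmxK].
apply/seteqP; split=> [_ [S PS <-]|S PS]; first exact: PD_inv.
by exists (invmx S); [exact: PD_inv|exact: invmxK].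
Qed.

Lemma model_submanifold G :
  smooth_submanifold (Sym2 R n) (PD R n) (model R G).
Proof.
apply: (@pattern_submanifold _ _ (nonedge G)) => [S /modelP[]//|P /modelP[PP _]].
exists (PD R n), (PD R n), invmx, invmx; split=> // [|S PS].
  exact: diffeo_invmx.
by split=> [/modelP[]//|S0]; apply/modelP.
Qed.

Lemma model_inv_submanifold H :
  smooth_submanifold (Sym2 R n) (PD R n) (model_inv R H).
Proof.
apply: (@pattern_submanifold _ _ (nonedge H)) => [S /model_invP[]//|].
move=> P /model_invP[PP _].
exists (PD R n), (PD R n), id, id; split=> // [|S PS].
  exact: diffeo_id.
by split=> [/model_invP[]//|S0]; apply/model_invP.
Qed.

Lemma double_model_submanifold G H : is_complete (graph_union G H) ->
  smooth_submanifold (Sym2 R n) (PD R n) (double_model R G H).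
Proof.
move=> GH; pose Z i j := nonedge G i j || nonedge H i j.
apply: (@pattern_submanifold _ _ Z) => [S [/modelP[]]//|P [/modelP[PP _] _]].
have uP := PD_unit PP; have [sP _] := PP.
have inj D : mixed_diff (nonedge G) P P D = 0 -> D = 0 by exact: mixed_diff_inj.
have := mixed_local_inverse uP inj (PD_near_sym PP).
move=> [r [W [g [r0 bN oW WP [finj gP gsm]]]]].
pose b := [set S : 'M[R]_n | `|P - S| < r].
pose f := @mixed_map R n (nonedge G).
have bopen : open b by have := @ball_open R _ P r; rewrite -ball_normE; apply.
have fsm : smooth_on setT b f.
  by apply: mixed_map_smooth => // S /bN[].
have oU : open (b `&` f @^-1` W).
  have [] := fsm 0%N; rewrite continuous_open_subspace// => fc _.
  by have [+ _] := continuous_inP f bopen; apply.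
pose U := b `&` f @^-1` W `&` Sym2 R n.
have ftr S : f S^T = (f S)^T by apply: mixed_map_tr; exact: nonedge_sym.
exists U, (W `&` Sym2 R n), f, g; split.
- by split=> //; split=> //; rewrite /b/= subrr normr0.
- by move=> S [[bS _] sS]; have [+ _] := bN S bS; apply.
- split.
  + by exists (b `&` f @^-1` W).
  + by exists W.
  + apply/seteqP; split=> [_ [S [[bS WS] sS] <-]|y [Wy sy]].
      by split=> //; rewrite /Sym2/= -ftr sS.
    have [bg fg] := gP y Wy; exists (g y) => //.
    split; first by split=> //; rewrite /preimage/= /f fg.
    (* [g y] is symmetric by local injectivity: it and its transpose both map to [y], and the ball
       around the symmetric [P] is stable under transposition. *)
    apply: finj => //; last by rewrite -/f ftr /f fg.
    by rewrite /= -[in ltLHS]sP -linearB/= mx_norm_tr.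
  + by move=> S [[bS WS] _]; have [bg fg] := gP _ WS; apply: finj.
  + split; [apply: smooth_on_sub fsm|apply: smooth_on_sub gsm] => //.
    by move=> S [[]].
- move=> S [[bS _] sS]; have PS : PD R n S by have [+ _] := bN S bS; apply.
  split=> [[/modelP[_ S0] /model_invP[_ S1]] i j|fS].
    rewrite /Z /f mxE; have [Gij _|_ /= Hij] := boolP (nonedge G i j).
      by rewrite S0// oppr0.
    exact: S1.
  split; [apply/modelP|apply/model_invP]; split=> // i j ne.
    have := fS i j; rewrite /Z ne /f mxE ne => /(_ isT)/eqP.
    by rewrite oppr_eq0 => /eqP.
  (* A non-edge of [H] is not one of [G], so [f] records the entry of [S] itself there. *)
  by have := fS i j; rewrite /Z ne orbT /f mxE (nonedge_complete GH ne); apply.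
Qed.

End Charts.

(** * Tangent vectors and transversality *)

Section TangentSpaces.
Context {R : realType} {n : nat}.
Implicit Types (P v w : 'M[R]_n) (c d : R -> 'M[R]_n).

(** Carathéodory's form of the derivative: a slope function continuous at 0 has the derivative as
    its value there. *)
Lemma is_derive_slope c d : {for 0, continuous d} ->
  (\forall t \near 0, c t = c 0 + t *: d t) -> is_derive (0 : R) 1 c (d 0).
Proof.
move=> dcont cd.
suff lim : h^-1 *: ((c \o shift 0) (h *: (1 : R)) - c 0) @[h --> (0 : R)^'] -->
    d 0.
  apply: DeriveDef; first by apply/cvg_ex; exists (d 0).
  exact/cvg_lim.
apply: (@cvg_trans _ (d @ (0 : R)^')); last exact: cvg_within_filter.
apply: near_eq_cvg; near=> h.
have h0 : h != 0 by near: h; exact: nbhs_dnbhs_neq.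
have ch : c h = c 0 + h *: d h by near: h; exact: nbhs_dnbhs.
have -> : (c \o shift 0) (h *: (1 : R)) = c h.
  by congr c; rewrite /= addr0 [LHS]mulr1.
by rewrite ch addrAC subrr add0r scalerA mulVf// scale1r.
Unshelve. all: by end_near. Qed.

Lemma tangentI (A : set 'M[R]_n) c (e : R) v : 0 < e ->
  rational_mx [set (id : R -> R)] [set t : R | `|t| < e] c ->
  (forall t, `|t| < e -> A (c t)) -> is_derive (0 : R) 1 c v ->
  tangent_space A (c 0) v.
Proof.
move=> e0 rc Ac [dc vc]; exists c, e; split=> //; last by rewrite derive1E.
apply: rational_mx_smooth rc; last exact: id_differential.
rewrite (_ : [set t : R | `|t| < e] = ball_ Num.Def.normr 0 e).
  by rewrite ball_normE; exact: ball_open.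
by apply/seteqP; split=> t; rewrite /ball_/= sub0r normrN.
Qed.

Lemma rational_line (U : set R) P v :
  rational_mx [set (id : R -> R)] U (fun t => P + t *: v).
Proof.
apply: rational_mxD; first exact: rational_mx_cst.
move=> i j; have r := rat_mul (@rat_gen _ _ [set (id : R -> R)] U id erefl)
  (rat_cst _ U (v i j)).
by apply: rat_ext r => t _; rewrite mxE.
Qed.

Lemma line_continuous P v : continuous (fun t : R => P + t *: v).
Proof.
move=> t; apply: (rational_mx_continuous openT (id_differential setT)) => //.
exact: rational_line.
Qed.

Lemma PD_line P v : PD R n P -> Sym2 R n v ->
  exists2 e : R, 0 < e & forall t, `|t| < e -> PD R n (P + t *: v).
Proof.
move=> PP sv.
have : \forall t \near (0 : R), Sym2 R n (P + t *: v) -> PD R n (P + t *: v).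
  apply: (@line_continuous P v 0 [set S | Sym2 R n S -> PD R n S]).
  by rewrite scale0r addr0; exact: PD_near_sym.
move=> /nbhs_normP[e /= e0 eP]; exists e => // t te.
apply: eP; first by rewrite /ball_/= sub0r normrN.
by rewrite /Sym2/= linearD linearZ/= sv PP.1.
Qed.

Lemma tangent_line (A : set 'M[R]_n) P v (e : R) : 0 < e ->
  (forall t, `|t| < e -> A (P + t *: v)) -> tangent_space A P v.
Proof.
move=> e0 Ae; pose c (t : R) := P + t *: v.
have -> : P = c 0 by rewrite /c scale0r addr0.
apply: (tangentI e0) => //; first exact: rational_line.
apply: (@is_derive_slope c (fun=> v)); first exact: cvg_cst.
by apply: (@nearW _ (nbhs (0 : R))) => t; rewrite /c scale0r addr0.
Qed.

Lemma tangent_Sym2 (A : set 'M[R]_n) P v :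
  A `<=` Sym2 R n -> tangent_space A P v -> Sym2 R n v.
Proof.
move=> AS [c [e [e0 csm Ac _ <-]]].
have c0 : [set t : R | `|t| < e] 0 by rewrite /= normr0.
have [_ /(_ 1 I)[/(_ 0 c0) dc _]] := csm 1%N.
rewrite derive1E derive_mx//; apply/matrixP => i j; rewrite !mxE.
apply: near_eq_derive; near=> t.
have : Sym2 R n (c t).
  apply/AS/Ac; near: t; apply/nbhs_normP; exists e => // t.
  by rewrite /ball_/= sub0r normrN.
by move=> /(congr1 (fun M : 'M[R]_n => M i j)); rewrite mxE.
Unshelve. all: by end_near. Qed.

Lemma tangent_PD P v : PD R n P -> tangent_space (PD R n) P v <-> Sym2 R n v.
Proof.
move=> PP; split; first by apply: tangent_Sym2 => S [].
by move=> /(PD_line PP)[e e0 eP]; exact: tangent_line eP.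
Qed.

Lemma tangent_model_inv (H : sgraph n) P v : model_inv R H P -> Sym2 R n v ->
  (forall i j, nonedge H i j -> v i j = 0) -> tangent_space (model_inv R H) P v.
Proof.
move=> /model_invP[PP P0] sv v0; have [e e0 eP] := PD_line PP sv.
apply: (tangent_line e0) => t /eP PDt; apply/model_invP; split=> // i j ne.
by rewrite !mxE P0// v0// mulr0 addr0.
Qed.

(** The curve is the inverse of the line [Q + t w] with [Q = P^-1] and [w = - Q v Q]. The line keeps
    the zeros of [Q] on non-edges, and the velocity of its inverse at 0 is [- P w P = v]. *)
Lemma tangent_model (G : sgraph n) P v : model R G P -> Sym2 R n v ->
  (forall i j, nonedge G i j -> (invmx P *m v *m invmx P) i j = 0) ->
  tangent_space (model R G) P v.
Proof.
move=> /modelP[PP P0] sv v0; have uP := PD_unit PP; have [sP _] := PP.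
pose Q := invmx P; pose w := - (Q *m v *m Q).
have sw : Sym2 R n w.
  by rewrite /Sym2/= linearN/= !trmx_mul invmx_sym// sv mulmxA.
have [e e0 eP] := PD_line (PD_inv PP) sw.
pose c (t : R) := invmx (Q + t *: w).
have c0 : c 0 = P by rewrite /c scale0r addr0 invmxK.
have rc : rational_mx [set (id : R -> R)] [set t : R | `|t| < e] c.
  by apply: rational_invmx; [move=> t /eP/PD_unit|exact: rational_line].
have oe : open [set t : R | `|t| < e].
  rewrite (_ : [set t : R | `|t| < e] = ball_ Num.Def.normr 0 e).
    by rewrite ball_normE; exact: ball_open.
  by apply/seteqP; split=> t; rewrite /ball_/= sub0r normrN.
have e00 : [set t : R | `|t| < e] 0 by rewrite /= normr0.
rewrite -c0; apply: (tangentI e0 rc).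
  move=> t /eP PDt; apply/modelP; split=> [|i j ne]; first exact: PD_inv.
  by rewrite invmxK mxE [X in _ + X]mxE [w i j]mxE v0// P0// oppr0 mulr0 addr0.
have -> : v = c 0 *m (- w) *m P.
  by rewrite c0 /w opprK !mulmxA mulmxV// mul1mx mulmxKV.
apply: (@is_derive_slope c (fun t => c t *m (- w) *m P)).
  apply: (rational_mx_continuous oe (id_differential _)) => //.
  by do 2![apply: rational_mxM; last exact: rational_mx_cst].
(* The resolvent identity [c t - P = c t (Q - (Q + t w)) P] exhibits the slope [c t (- w) P]
   exactly. *)
apply: (near_open oe) => // t /eP PDt; rewrite c0.
have ut := PD_unit PDt.
have -> : t *: (c t *m (- w) *m P) = c t *m (Q - (Q + t *: w)) *m P.
  by rewrite opprD addrA subrr add0r -scalerN -scalemxAr -scalemxAl.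
rewrite mulmxBr mulmxBl mulVmx// mul1mx -mulmxA mulVmx// mulmx1.
by rewrite addrC subrK.
Qed.

Lemma models_transverse (G H : sgraph n) P :
  is_complete (graph_union G H) -> double_model R G H P ->
  transverse_at (PD R n) (model R G) (model_inv R H) P.
Proof.
move=> GH [PG PH]; have [PP _] := (modelP _ _).1 PG.
have [sP _] := PP; have sQ := invmx_sym sP.
apply/seteqP; split=> v.
  move=> [a ta [b tb <-]]; apply/(tangent_PD _ PP).
  have sa : Sym2 R n a by apply: tangent_Sym2 ta => S /modelP[[]].
  have sb : Sym2 R n b by apply: tangent_Sym2 tb => S /model_invP[[]].
  by rewrite /Sym2/= linearD/= sa sb.
move=> /(tangent_PD _ PP) sv.
pose C := nonedge G; pose J := @mixed_diff R n C P P.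
have uJ : lin_mx J \in unitmx by apply: mixed_diff_unit => D; exact: mixed_diff_inj.
pose y := pattern_part C (invmx P *m v *m invmx P).
pose b := mixed_solve C P P y.
have Jb : J b = y by exact: mixed_diffK.
have sy : y^T = y.
  have sQvQ : (invmx P *m v *m invmx P)^T = invmx P *m v *m invmx P.
    by rewrite !trmx_mul sQ sv mulmxA.
  apply/matrixP => i j; rewrite [LHS]mxE ![y _ _]mxE /C (nonedge_sym G j i).
  by rewrite -[in LHS]sQvQ mxE.
(* Since [y] is symmetric, the transpose of [b] solves the same equation, and solutions are
   unique. *)
have sb : Sym2 R n b.
  have JbT : J b^T = y.
    by rewrite /J (mixed_diff_tr _ (nonedge_sym G) sP) -/(J b) Jb.
  by rewrite /Sym2/= -[LHS](mixed_solveK _ uJ) -/(J b^T) JbT.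
have bC i j : ~~ C i j -> b i j = 0.
  move=> Cij; have := congr1 (fun M : 'M[R]_n => M i j) Jb.
  by rewrite mxE [RHS]mxE (negbTE Cij).
have bC' i j : C i j -> (invmx P *m b *m invmx P) i j = (invmx P *m v *m invmx P) i j.
  move=> Cij; have := congr1 (fun M : 'M[R]_n => M i j) Jb.
  by rewrite mxE [RHS]mxE Cij.
exists (v - b).
  apply: tangent_model => // [|i j Cij]; first by rewrite /Sym2/= linearB/= sv sb.
  by rewrite mulmxBr mulmxBl mxE [X in _ + X]mxE bC'// subrr.
exists b; last by rewrite subrK.
(* [b] is supported on non-edges of [G], which are disjoint from those of [H]. *)
apply: tangent_model_inv => // i j ne.
by apply: bC; rewrite /C (nonedge_complete GH ne).
Qed.

End TangentSpaces.

Theorem theorem3p8 (R : realType) (n : nat) (G H : sgraph n)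
    (GH_complete : is_complete (graph_union G H)) :
  smooth_submanifold (Sym2 R n) (PD R n) (double_model R G H) /\
  [/\ smooth_submanifold (Sym2 R n) (PD R n) (model R G),
      smooth_submanifold (Sym2 R n) (PD R n) (model_inv R H) &
      forall P : 'M[R]_n, double_model R G H P ->
        transverse_at (PD R n) (model R G) (model_inv R H) P].
Proof.
split; first exact: double_model_submanifold.
split; [exact: model_submanifold|exact: model_inv_submanifold|].
by move=> P; exact: models_transverse.
Qed.
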